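(* Let $n\ge 1$, let $\boldsymbol{a},\boldsymbol{b}\in\mathbb{R}^n$ with $a_i<b_i$ for all $i$, and let $f:[\boldsymbol{a},\boldsymbol{b}]\to\mathbb{R}$ be a jointly monotone increasing function on the rectangle $[\boldsymbol{a},\boldsymbol{b}]=\prod_{i=1}^n[a_i,b_i]$. Then the joint derivative $f^{(n)}(\boldsymbol{x})$ exists for (Lebesgue) almost every $\boldsymbol{x}\in[\boldsymbol{a},\boldsymbol{b}]$, and $$\int_{[\boldsymbol{a},\boldsymbol{b}]} f^{(n)}(\boldsymbol{x})\,d\boldsymbol{x}\le \Delta_f^n[\boldsymbol{a},\boldsymbol{b}].$$
   Context: For $\boldsymbol{c},\boldsymbol{d}\in\mathbb{R}^n$, $\boldsymbol{c}\le\boldsymbol{d}$ means $c_i\le d_i$ for all $i$, and $[\boldsymbol{c},\boldsymbol{d}]=\prod_i[c_i,d_i]$. The joint increment of $f$ over $[\boldsymbol{c},\boldsymbol{d}]$ is $$\Delta_f^n[\boldsymbol{c},\boldsymbol{d}]=\sum_{\epsilon_1,\dots,\epsilon_n\in\{0,1\}}(-1)^{n+\epsilon_1+\dots+\epsilon_n}f\big(c_1+\epsilon_1(d_1-c_1),\dots,c_n+\epsilon_n(d_n-c_n)\big).$$ $f$ is jointly monotone increasing on $[\boldsymbol{a},\boldsymbol{b}]$ if $\Delta_f^n[\boldsymbol{x},\boldsymbol{y}]\ge 0$ for all $\boldsymbol{x}\le\boldsymbol{y}$ in $[\boldsymbol{a},\boldsymbol{b}]$. The joint derivative of $f$ at a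 point $\boldsymbol{x}$ in a neighborhood of which $f$ is defined is $$f^{(n)}(\boldsymbol{x})=\lim_{h\to0^+}\frac{\Delta_f^n\big([x_1,x_1+h]\times\dots\times[x_n,x_n+h]\big)}{h^n},$$ when the limit exists (as a finite real number). Integrals are Lebesgue integrals; $f^{(n)}$ is integrated as an almost everywhere defined function. *)

(* Defs.v *)
From HB Require Import structures.
From mathcomp Require Import all_boot all_order all_algebra.
From mathcomp Require Import all_classical all_reals all_analysis.

Set Implicit Arguments.
Unset Strict Implicit.
Unset Printing Implicit Defensive.
Import Order.TTheory GRing.Theory Num.Theory.
Import numFieldNormedType.Exports.

Local Open Scope classical_set_scope.
Local Open Scope ring_scope.

Section boxes.
Context {R : realType} {n : nat}.
Implicit Types (c d : 'rV[R]_n) (f : 'rV[R]_n -> R).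

Definition vec_le c d : Prop := forall i, c 0 i <= d 0 i.

Definition box c d : set 'rV[R]_n := [set x | vec_le c x /\ vec_le x d].

Definition box_vol c d : R := \prod_(i < n) (d 0 i - c 0 i).

Definition box_corner c d (e : {ffun 'I_n -> bool}) : 'rV[R]_n :=
  \row_i (c 0 i + (e i)%:R * (d 0 i - c 0 i)).

Definition joint_increment f c d : R :=
  \sum_(e : {ffun 'I_n -> bool})
    (-1) ^+ (n + \sum_(i < n) e i) * f (box_corner c d e).

Definition jointly_monotone a b f : Prop :=
  forall x y, box a b x -> box a b y -> vec_le x y ->
    0 <= joint_increment f x y.

(* [f] is only meaningful on [D]: a joint derivative at [x] presupposes that
   [D] is a neighborhood of [x], so the values of [f] off [D] play no role. *)
Definition has_joint_derivative (D : set 'rV[R]_n) f (x : 'rV[R]_n) (l : R)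
    : Prop :=
  nbhs x D /\
  joint_increment f x (x + const_mx h) / h ^+ n @[h --> 0^'+] --> l.

Definition joint_derivable (D : set 'rV[R]_n) f (x : 'rV[R]_n) : Prop :=
  exists l : R, has_joint_derivative D f x l.

(* Set to 0 at the points where the joint derivative does not exist. *)
Definition joint_derivative (D : set 'rV[R]_n) f (x : 'rV[R]_n) : R :=
  xget 0 [set l | has_joint_derivative D f x l].

End boxes.

Section lebesgue_outer_measure.
Local Open Scope ereal_scope.
Context {R : realType} {n : nat}.

(* The covers are countable, not necessarily infinite: for [n = 0] no box is
   negligible, and only the empty family gives the empty set measure 0. *)
Definition box_cover (A : set 'rV[R]_n) (I : set nat) (c d : nat -> 'rV[R]_n)
    : Prop :=
  (forall k, I k -> vec_le (c k) (d k)) /\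
  A `<=` \bigcup_(k in I) box (c k) (d k).

Definition lebesgue_outer (A : set 'rV[R]_n) : \bar R :=
  ereal_inf [set v | exists I c d, box_cover A I c d /\
                     v = \esum_(k in I) (box_vol (c k) (d k))%:E].

Lemma box_vol_ge0 (c d : 'rV[R]_n) : vec_le c d -> (0 <= box_vol c d)%R.
Proof. by move=> cd; apply: prodr_ge0 => i _; rewrite subr_ge0. Qed.

Lemma lebesgue_outer_ge0 A : 0 <= lebesgue_outer A.
Proof.
apply: le_ereal_inf_tmp => _ [I [c [d [[cd _] ->]]]].
by apply: esum_ge0 => k /cd /box_vol_ge0; rewrite lee_fin.
Qed.

Lemma lebesgue_outer0 : lebesgue_outer set0 = 0.
Proof.
apply/eqP; rewrite eq_le lebesgue_outer_ge0 andbT.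
apply: ereal_inf_lbound; exists set0, (fun=> 0%R), (fun=> 0%R).
by rewrite esum_set0; split=> //; split.
Qed.

Lemma le_lebesgue_outer :
  {homo lebesgue_outer : A B / A `<=` B >-> A <= B}.
Proof.
move=> A B AB; apply/ereal_inf_le_tmp => v [I [c [d [[cd BI] ->]]]].
by exists I, c, d; split=> //; split=> //; exact: subset_trans BI.
Qed.

Lemma lebesgue_outer_sigma_subadditive : sigma_subadditive lebesgue_outer.
Proof.
move=> A; have [[i ioo]|] := pselect (exists i, lebesgue_outer (A i) = +oo).
  rewrite (eseries_pinfty _ _ ioo) ?leey// => k _.
  by rewrite -ltNye (lt_le_trans _ (lebesgue_outer_ge0 _)).
rewrite -forallNE => Aoo; apply/lee_addgt0Pr => e e0.
apply: le_trans (epsilon_trick _ (fun=> lebesgue_outer_ge0 _) (ltW e0)).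
pose P k (G : set nat * (nat -> 'rV[R]_n) * (nat -> 'rV[R]_n)) :=
  box_cover (A k) G.1.1 G.1.2 G.2 /\
  \esum_(j in G.1.1) (box_vol (G.1.2 j) (G.2 j))%:E
    <= lebesgue_outer (A k) + (e / (2 ^ k.+1)%:R)%:E.
have [G PG] : {G & forall k, P k (G k)}.
  apply: (@choice _ _ P) => k.
  have ek0 : (0 < e / (2 ^ k.+1)%:R)%R by rewrite divr_gt0// ltr0n expn_gt0.
  have fk : lebesgue_outer (A k) \is a fin_num.
    rewrite ge0_fin_numE ?lebesgue_outer_ge0// ltey.
    exact/eqP/Aoo.
  have [_ [I [c [d [cov ->]]]] lt] := lb_ereal_inf_adherent ek0 fk.
  by exists (I, c, d); split=> //; exact: ltW.
pose J := [set: nat] `*`` (fun k => (G k).1.1).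
pose u (j : nat) : nat * nat := odflt (0%N, 0%N) (unpickle j).
have uK p : u (pickle p) = p by rewrite /u pickleK.
apply: (@le_trans _ _ (\esum_(p in J)
    (box_vol ((G p.1).1.2 p.2) ((G p.1).2 p.2))%:E)).
  apply: ereal_inf_lbound; exists (pickle @` J),
    (fun j => (G (u j).1).1.2 (u j).2), (fun j => (G (u j).1).2 (u j).2).
  split; [split|].
  - by move=> _ [p [_ Jp] <-]; rewrite uK; exact: (PG p.1).1.1.
  - move=> x [k _ /((PG k).1.2) [j Ij xj]].
    by exists (pickle (k, j)); [exists (k, j)|rewrite /= uK].
  - rewrite esum_image; last by move=> p q _ _; exact: (can_inj uK).
    by apply: eq_esum => p _; rewrite uK.
rewrite -(esum_esum (a := fun k j => (box_vol ((G k).1.2 j) ((G k).2 j))%:E)).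
  rewrite [leRHS]nneseries_esumT; last first.
    by move=> k; rewrite adde_ge0 ?lebesgue_outer_ge0// lee_fin divr_ge0 ?ltW.
  by apply: le_esum => k _; exact: (PG k).2.
by move=> k j _ Ij; rewrite lee_fin box_vol_ge0//; exact: (PG k).1.1.
Qed.

HB.instance Definition _ := isOuterMeasure.Build R 'rV[R]_n lebesgue_outer
  lebesgue_outer0 lebesgue_outer_ge0 le_lebesgue_outer
  lebesgue_outer_sigma_subadditive.

End lebesgue_outer_measure.

(* R^n with the complete sigma-algebra of the Lebesgue-measurable sets, i.e. the
   Caratheodory-measurable sets of the outer measure. *)
Definition lebesgue_space (R : realType) (n : nat) : measurableType _ :=
  caratheodory_type
    (@lebesgue_outer R n : {outer_measure set 'rV[R]_n -> \bar R}).

Definition lebesgue_measure_rV (R : realType) (n : nat) :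
  set (lebesgue_space R n) -> \bar R := @lebesgue_outer R n.

HB.instance Definition _ (R : realType) (n : nat) :=
  let mu : {outer_measure set 'rV[R]_n -> \bar R} := @lebesgue_outer R n in
  isMeasure.Build _ _ _ (@lebesgue_measure_rV R n)
    (caratheodory_measure0 mu) (caratheodory_measure_ge0 (mu := mu))
    (caratheodory_measure_sigma_additive (mu := mu)).

(* Main.v *)
(* Replace f by the interval function phi[c,d] = Delta_f[clamp c, clamp d], where
   clamp is the projection onto [a,b]: it is nonnegative, additive under cuts by
   hyperplanes, and defined on all of R^n, even when f is not measurable.
   Let p < q and let E be the set of the points of (a,b) that lie in arbitrarily
   small cubes with phi <= p vol and in arbitrarily small cubes with phi >= q vol.
   Applying Vitali's covering theorem inside a box Q gives lam(E & Q) <= phi(Q)/q,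
   and applying it again inside a box B to cubes Q with phi(Q) <= p vol(Q) gives
   lam(E & B) <= (p/q) vol(B). Summing over the boxes of a cover of E yields
   lam(E) <= (p/q) lam(E), so E is null; the points of infinite upper derivative
   are handled by the first estimate alone. Hence phi(Q)/vol(Q) converges almost
   everywhere as the cube Q shrinks to a point x in Q (not only for x a corner
   of Q). The step functions equal to phi(Q)/vol(Q) on the cells Q of finer and
   finer grids therefore converge to the joint derivative almost everywhere; their
   integrals are at most Delta_f[a,b], and Fatou's lemma concludes. *)
Require Import Defs.
From HB Require Import structures.
From mathcomp Require Import all_boot all_order all_algebra.
From mathcomp Require Import all_classical all_reals all_analysis.
From mathcomp Require Import measurable_realfun.
From mathcomp Require Import ring lra.

Set Implicit Arguments.
Unset Strict Implicit.
Unset Printing Implicit Defensive.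

Import Order.TTheory GRing.Theory Num.Theory.
Import numFieldNormedType.Exports.

Local Open Scope classical_set_scope.
Local Open Scope ring_scope.

(** * Interval functions *)

Section interval_functions.
Context {R : realType} {n : nat}.
Implicit Types (a b c d x : 'rV[R]_n) (i : 'I_n) (t : R).
Implicit Types (phi : 'rV[R]_n -> 'rV[R]_n -> R).

Definition setc x i t : 'rV[R]_n := \row_j (if j == i then t else x 0 j).

Lemma setcE x i t j : setc x i t 0 j = if j == i then t else x 0 j.
Proof. by rewrite mxE. Qed.

Lemma setc_id x i : setc x i (x 0 i) = x.
Proof. by apply/rowP => j; rewrite setcE; case: eqP => [->|]. Qed.

(** No order between [c], [d] and [t] is assumed: [phi] is signed, like an integral between oriented
    bounds. *)
Definition cut_additive phi := forall c d i t,
  phi c d = phi c (setc d i t) + phi (setc c i t) d.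

Definition nonnegative phi := forall c d, vec_le c d -> 0 <= phi c d.

Lemma vec_le_trans x c d : vec_le c x -> vec_le x d -> vec_le c d.
Proof. by move=> cx xd i; exact: le_trans (cx i) (xd i). Qed.

(** Cutting at the common coordinate yields [phi c d = phi c d + phi c d]. *)
Lemma cut_additive_degenerate phi c d i :
  cut_additive phi -> c 0 i = d 0 i -> phi c d = 0.
Proof.
move=> phiA cdi; have := phiA c d i (c 0 i).
by rewrite {1}cdi !setc_id => /eqP; rewrite -subr_eq0 opprD addNKr oppr_eq0 => /eqP.
Qed.

(** Corners are paired with their mirror images in direction [i], which carry the opposite sign. The
    corners on the cutting hyperplane then occur once with each sign and cancel. *)
Lemma cut_additive_joint_increment (f : 'rV[R]_n -> R) :
  cut_additive (joint_increment f).
Proof.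
move=> c d i t.
pose flip (e : {ffun 'I_n -> bool}) : {ffun 'I_n -> bool} :=
  [ffun j => if j == i then ~~ e j else e j].
have flipK : involutive flip.
  by move=> e; apply/ffunP => j; rewrite !ffunE; case: eqP => // _; rewrite negbK.
have splitE c' d' : joint_increment f c' d' =
    \sum_(e : {ffun 'I_n -> bool} | e i)
      ((-1) ^+ (n + \sum_(j < n) e j) * f (box_corner c' d' e) -
       (-1) ^+ (n + \sum_(j < n) e j) * f (box_corner c' d' (flip e))).
  rewrite /joint_increment (bigID (fun e : {ffun 'I_n -> bool} => e i)) /=
    big_split /=; congr (_ + _).
  rewrite (reindex_inj (inv_inj flipK)) /=.
  under eq_bigl do rewrite ffunE eqxx negbK.
  apply: eq_bigr => e ei; rewrite -mulNr; congr (_ * _).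
  rewrite (bigD1 i) //= [in RHS](bigD1 i) //= ffunE eqxx ei /= add0n.
  rewrite !exprD mulN1r -!mulrN opprK; congr (_ * (-1) ^+ _).
  by apply: eq_bigr => j ji; rewrite ffunE (negbTE ji).
rewrite !splitE -big_split; apply: eq_bigr => e ei /=.
have <- : box_corner (setc c i t) d e = box_corner c d e.
  apply/rowP => j; rewrite !mxE; case: eqP => // ->; rewrite ei /=; ring.
have <- : box_corner c (setc d i t) (flip e) = box_corner c d (flip e).
  by apply/rowP => j; rewrite !mxE ffunE; case: eqP => // ->; rewrite ei /=; ring.
have <- : box_corner c (setc d i t) e = box_corner (setc c i t) d (flip e).
  by apply/rowP => j; rewrite !mxE ffunE; case: eqP => // ->; rewrite ei /=; ring.
ring.
Qed.

Lemma cut_additive_box_vol : cut_additive (@box_vol R n).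
Proof.
move=> c d i t.
have volE c' d' : box_vol c' d' =
    (d' 0 i - c' 0 i) * \prod_(j < n | j != i) (d' 0 j - c' 0 j).
  by rewrite /box_vol (bigD1 i).
have volP c' d' : (forall j, j != i -> c' 0 j = c 0 j) ->
    (forall j, j != i -> d' 0 j = d 0 j) ->
    box_vol c' d' = (d' 0 i - c' 0 i) * \prod_(j < n | j != i) (d 0 j - c 0 j).
  by move=> cc dd; rewrite volE; congr (_ * _); apply: eq_bigr => j ji;
    rewrite cc ?dd.
rewrite !volP//; last 2 first.
- by move=> j /negbTE ji; rewrite setcE ji.
- by move=> j /negbTE ji; rewrite setcE ji.
by rewrite !setcE eqxx -mulrDl; congr (_ * _); ring.
Qed.

(** Applied to both corners of a box, [minc] gives its part below the hyperplane x_i = t and [maxc]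
    its part above. If the hyperplane misses the box, one part is the whole box and the other is
    degenerate. *)
Definition minc x i t := setc x i (Num.min (x 0 i) t).
Definition maxc x i t := setc x i (Num.max (x 0 i) t).

Lemma mincE x i t j : minc x i t 0 j = if j == i then Num.min (x 0 i) t else x 0 j.
Proof. exact: setcE. Qed.

Lemma maxcE x i t j : maxc x i t 0 j = if j == i then Num.max (x 0 i) t else x 0 j.
Proof. exact: setcE. Qed.

Lemma vec_le_minc c d i t : vec_le c d -> vec_le (minc c i t) (minc d i t).
Proof.
move=> cd j; rewrite !mincE; case: eqP => [_|] //.
by rewrite le_min !ge_min lexx cd orbT.
Qed.

Lemma vec_le_maxc c d i t : vec_le c d -> vec_le (maxc c i t) (maxc d i t).
Proof.
move=> cd j; rewrite !maxcE; case: eqP => [_|] //.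
by rewrite ge_max !le_max lexx cd orbT.
Qed.

Lemma cut_additive_minmax phi c d i t : cut_additive phi -> vec_le c d ->
  phi c d = phi (minc c i t) (minc d i t) + phi (maxc c i t) (maxc d i t).
Proof.
move=> phiA cd; rewrite /minc /maxc.
have deg u v : phi (setc u i t) (setc v i t) = 0.
  by apply: (cut_additive_degenerate (i := i) phiA); rewrite !setcE eqxx.
have [dt|td] := leP (d 0 i) t.
  have ct : c 0 i <= t by exact: le_trans (cd i) dt.
  by rewrite (min_l ct) (max_r ct) !setc_id deg addr0.
have [ct|tc] := leP (c 0 i) t; first by rewrite !setc_id; exact: phiA.
by rewrite !setc_id deg add0r.
Qed.

(** Half-open, so that boxes sharing only a face are disjoint and grid cells partition a cube. *)
Definition hbox c d : set 'rV[R]_n := [set x | forall i, c 0 i <= x 0 i < d 0 i].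

Lemma hbox_minc c d i t : hbox (minc c i t) (minc d i t) `<=` hbox c d.
Proof.
move=> x xQ j; have := xQ j; rewrite !mincE; case: eqP => // -> /andP[cx].
by rewrite lt_min => /andP[-> xt]; rewrite andbT; move: cx;
  rewrite ge_min [t <= _]leNgt xt orbF.
Qed.

Lemma hbox_maxc c d i t : hbox (maxc c i t) (maxc d i t) `<=` hbox c d.
Proof.
move=> x xQ j; have := xQ j; rewrite !maxcE; case: eqP => // -> /andP[].
by rewrite ge_max => /andP[-> xt]; rewrite lt_max [_ < t]ltNge xt orbF.
Qed.

(** [L] lists the hyperplanes x_i = t still to be cut along. A cut at the head of [L] turns that
    hyperplane into a facet of both halves of [a, b], so it leaves the list; this drives the
    induction in [superadditive]. *)
Let cutP (L : seq ('I_n * R)) a b x := forall i,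
  [\/ x 0 i = a 0 i, x 0 i = b 0 i | (i, x 0 i) \in L].

Let cutP_minc L i t a b x : vec_le x b -> cutP ((i, t) :: L) a b x ->
  cutP L (minc a i t) (minc b i t) (minc x i t).
Proof.
move=> xb xL j; rewrite !mincE; have := xL j; have := xb j.
case: eqP => [->|ji] xbj.
  have [xt|tx] := leP (x 0 i) t; last first.
    by move=> _; apply: Or32; rewrite min_r// (le_trans (ltW tx)).
  case=> [xa|xb'|]; [apply: Or31|apply: Or32|].
  - by rewrite -xa min_l.
  - by rewrite -xb' min_l.
  - rewrite in_cons => /predU1P[[xt']|]; last by move=> ?; apply: Or33.
    by apply: Or32; rewrite min_r// -xt'.
case=> [?|?|]; [exact: Or31|exact: Or32|].
by rewrite in_cons => /predU1P[[]//|?]; exact: Or33.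
Qed.

Let cutP_maxc L i t a b x : vec_le a x -> cutP ((i, t) :: L) a b x ->
  cutP L (maxc a i t) (maxc b i t) (maxc x i t).
Proof.
move=> ax xL j; rewrite !maxcE; have := xL j; have := ax j.
case: eqP => [->|ji] axj.
  have [tx|xt] := leP t (x 0 i); last first.
    by move=> _; apply: Or31; rewrite max_r// (le_trans axj)// ltW.
  case=> [xa|xb'|]; [apply: Or31|apply: Or32|].
  - by rewrite -xa max_l.
  - by rewrite -xb' max_l.
  - rewrite in_cons => /predU1P[[xt']|]; last by move=> ?; apply: Or33.
    by apply: Or31; rewrite max_r// -xt'.
case=> [?|?|]; [exact: Or31|exact: Or32|].
by rewrite in_cons => /predU1P[[]//|?]; exact: Or33.
Qed.

(* Cutting along every facet reduces to boxes equal to [a, b] or degenerate. *)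
Lemma superadditive phi (I : eqType) (s : seq I) (c d : I -> 'rV[R]_n) a b :
  cut_additive phi -> nonnegative phi -> vec_le a b -> uniq s ->
  {in s, forall k, [/\ vec_le a (c k), vec_le (c k) (d k) & vec_le (d k) b]} ->
  {in s &, forall j k, j != k -> hbox (c j) (d j) `&` hbox (c k) (d k) = set0} ->
  \sum_(k <- s) phi (c k) (d k) <= phi a b.
Proof.
move=> phiA phi0 ab us sub dis.
have [L cL] : exists L, {in s, forall k, cutP L a b (c k) /\ cutP L a b (d k)}.
  exists (flatten [seq [seq (i, c k 0 i) | i <- enum 'I_n] ++
                       [seq (i, d k 0 i) | i <- enum 'I_n] | k <- s]).
  move=> k ks; split=> i; apply: Or33; apply/flattenP;
    (exists ([seq (i, c k 0 i) | i <- enum 'I_n] ++ [seq (i, d k 0 i) | i <-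
      enum 'I_n]);
     first exact: map_f).
  - by rewrite mem_cat; apply/orP; left; apply/mapP; exists i => //;
      rewrite mem_enum.
  - by rewrite mem_cat; apply/orP; right; apply/mapP; exists i => //;
      rewrite mem_enum.
elim: L a b c d ab cL sub dis => [|[i t] L IH] a b c d ab cL sub dis.
  have zeroP k : k \in s -> phi (c k) (d k) = 0 \/
      [/\ c k = a, d k = b & forall i, a 0 i < b 0 i].
    move=> ks; have [ac cd db] := sub _ ks; have [ca da] := cL _ ks.
    have [[i cdi]|ncd] := pselect (exists i, c k 0 i = d k 0 i).
      by left; exact: cut_additive_degenerate cdi.
    have H i : [/\ c k 0 i = a 0 i, d k 0 i = b 0 i & a 0 i < b 0 i].
      have cdi : c k 0 i < d k 0 i.
        by rewrite lt_neqAle cd andbT; apply/eqP => h; apply: ncd; exists i.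
      have := ac i; have := db i; have := ca i; have := da i.
      by rewrite !in_nil => -[|//|//] hd -[||//] hc db' ac'; split; lra.
    by right; split; [apply/rowP => i; have [] := H i|
                      apply/rowP => i; have [] := H i|move=> i; have [] := H i].
  (* At most one term is nonzero: two such boxes would both equal [a, b], whose half-open box
     contains [a], against disjointness. *)
  have [[k0 k0s nz]|allz] := pselect (exists2 k, k \in s & phi (c k) (d k) <> 0).
    rewrite (bigD1_seq k0)//= big_seq_cond big1 ?addr0.
      by have [//|[-> ->]] := zeroP _ k0s.
    move=> j /andP[js jk0]; have [//|[cj dj ab']] := zeroP _ js.
    have [//|[ck dk _]] := zeroP _ k0s.
    have := dis _ _ js k0s jk0; rewrite cj dj ck dk setIid => /seteqP[/(_ a)+ _].
    by case=> i; rewrite lexx ab'.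
  rewrite big_seq big1 ?phi0// => k ks; apply/eqP/negP => /negP/eqP nz.
  by apply: allz; exists k.
rewrite (cut_additive_minmax i t phiA ab).
rewrite big_seq (eq_bigr (fun k => phi (minc (c k) i t) (minc (d k) i t) +
    phi (maxc (c k) i t) (maxc (d k) i t))); last first.
  by move=> k ks; apply: cut_additive_minmax => //; have [] := sub _ ks.
rewrite -big_seq big_split /=; apply: lerD.
  apply: (IH _ _ (fun k => minc (c k) i t) (fun k => minc (d k) i t)).
  - exact: vec_le_minc.
  - move=> k ks; have [ac cd db] := sub _ ks; have [? ?] := cL _ ks.
    by split; apply: cutP_minc => //; exact: vec_le_trans db.
  - by move=> k ks; have [ac cd db] := sub _ ks; split; exact: vec_le_minc.
  - move=> j k js ks jk; apply/seteqP; split=> // x [xj xk].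
    by rewrite -(dis _ _ js ks jk); split;
      [exact: hbox_minc xj|exact: hbox_minc xk].
apply: (IH _ _ (fun k => maxc (c k) i t) (fun k => maxc (d k) i t)).
- exact: vec_le_maxc.
- move=> k ks; have [ac cd db] := sub _ ks; have [? ?] := cL _ ks.
  by split; apply: cutP_maxc => //; exact: vec_le_trans cd.
- by move=> k ks; have [ac cd db] := sub _ ks; split; exact: vec_le_maxc.
- move=> j k js ks jk; apply/seteqP; split=> // x [xj xk].
  by rewrite -(dis _ _ js ks jk); split; [exact: hbox_maxc xj|exact: hbox_maxc xk].
Qed.

End interval_functions.

(** * The outer measure of boxes *)

Section outer_measure.
Context {R : realType} {n : nat}.
Implicit Types (a b c d x : 'rV[R]_n) (i : 'I_n) (t : R) (A : set 'rV[R]_n).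

Local Notation lam := (@lebesgue_outer R n).

Lemma lebesgue_outer_cover A (I : set nat) (c d : nat -> 'rV[R]_n) :
  (forall k, I k -> vec_le (c k) (d k)) ->
  A `<=` \bigcup_(k in I) box (c k) (d k) ->
  (lam A <= \esum_(k in I) (box_vol (c k) (d k))%:E)%E.
Proof. by move=> cd AI; apply: ereal_inf_lbound; exists I, c, d. Qed.

Lemma lebesgue_outer_box c d : vec_le c d ->
  (lam (box c d) <= (box_vol c d)%:E)%E.
Proof.
move=> cd; have cov : box c d `<=` \bigcup_(k in [set 0%N]) box c d.
  by move=> x xcd; exists 0%N.
have := lebesgue_outer_cover (c := fun=> c) (d := fun=> d) (fun _ _ => cd) cov.
by rewrite esum_set1// lee_fin box_vol_ge0.
Qed.

Lemma lebesgue_outer_bigcup0 (I : countType) (F : I -> set 'rV[R]_n) :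
  (forall j, lam (F j) = 0)%E -> lam (\bigcup_j F j) = 0%E.
Proof.
move=> F0; apply/eqP; rewrite eq_le lebesgue_outer_ge0 andbT.
pose G k := if @unpickle I k is Some i then F i else set0.
have G0 k : lam (G k) = 0%E.
  by rewrite /G; case: unpickle => [i|]; rewrite ?F0 ?lebesgue_outer0.
apply: (@le_trans _ _ (lam (\bigcup_k G k))).
  apply: le_lebesgue_outer => x [i _ Fi]; exists (pickle i) => //.
  by rewrite /G pickleK.
apply: (le_trans (lebesgue_outer_sigma_subadditive G)).
by rewrite eseries0// => k _ _; rewrite G0.
Qed.

Lemma lebesgue_outer_eq0 A : (lam A <= 0)%E -> lam A = 0%E.
Proof. by move=> A0; apply/eqP; rewrite eq_le A0 lebesgue_outer_ge0. Qed.

Lemma lebesgue_outer_setU A B : (lam (A `|` B) <= lam A + lam B)%E.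
Proof. exact: (outer_measureU2 (lam : {outer_measure set _ -> \bar R})). Qed.

Definition obox c d : set 'rV[R]_n := [set x | forall i, c 0 i < x 0 i < d 0 i].

(** The boundary is covered by the 2n faces, which are degenerate boxes of volume 0. *)
Lemma lebesgue_outer_boundary c d : vec_le c d ->
  lam (box c d `\` obox c d) = 0%E.
Proof.
move=> cd.
pose F (p : bool * 'I_n) := if p.1 then box c (setc d p.2 (c 0 p.2))
                            else box (setc c p.2 (d 0 p.2)) d.
have F0 p : lam (F p) = 0%E.
  case: p => -[] i; rewrite /F /=; apply: lebesgue_outer_eq0.
    apply: (le_trans (lebesgue_outer_box _)).
      by move=> j; rewrite setcE; case: eqP => [->|].
    rewrite lee_fin (cut_additive_degenerate (i := i) cut_additive_box_vol)//.
    by rewrite setcE eqxx.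
  apply: (le_trans (lebesgue_outer_box _)).
    by move=> j; rewrite setcE; case: eqP => [->|].
  rewrite lee_fin (cut_additive_degenerate (i := i) cut_additive_box_vol)//.
  by rewrite setcE eqxx.
apply: lebesgue_outer_eq0; rewrite -(lebesgue_outer_bigcup0 F0).
apply: le_lebesgue_outer => x [[cx xd] /= /existsNP[i /negP]].
rewrite negb_and -!leNgt => /orP[xc|dx].
  by exists (true, i) => //; split=> // j; rewrite setcE; case: eqP => [->|].
by exists (false, i) => //; split=> // j; rewrite setcE; case: eqP => [->|].
Qed.

(** Each box of a cover of X is cut along the hyperplane and the volumes add up. Both parts are
    closed, so it does not matter on which side the points of the hyperplane fall. *)
Lemma caratheodory_halfspace i t (H : set 'rV[R]_n) :
  [set x : 'rV[R]_n | x 0 i < t] `<=` H -> H `<=` [set x : 'rV[R]_n | x 0 i <= t] ->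
  caratheodory_measurable lam H.
Proof.
move=> ltH Hle.
apply: (le_caratheodory_measurable (mu := lam : {outer_measure set _ -> \bar
  R})) => X.
apply: le_ereal_inf_tmp => _ [I [c [d [[cd XI] ->]]]].
rewrite (eq_esum (b := fun k => (box_vol (minc (c k) i t) (minc (d k) i t))%:E +
    (box_vol (maxc (c k) i t) (maxc (d k) i t))%:E)%E); last first.
  move=> k Ik; rewrite -EFinD; congr (_%:E).
  by apply: cut_additive_minmax; [exact: cut_additive_box_vol|exact: cd].
rewrite esumD; first last.
- by move=> k Ik; rewrite lee_fin box_vol_ge0//; exact/vec_le_maxc/cd.
- by move=> k Ik; rewrite lee_fin box_vol_ge0//; exact/vec_le_minc/cd.
apply: leeD; apply: lebesgue_outer_cover.
- by move=> k Ik; exact/vec_le_minc/cd.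
- move=> x [/XI[k Ik [cx xd]] /Hle xt]; exists k => //.
  split=> j; rewrite mincE; case: eqP => // ->; first by rewrite ge_min cx.
  by rewrite le_min xd.
- by move=> k Ik; exact/vec_le_maxc/cd.
- move=> x [/XI[k Ik [cx xd]] Hx]; exists k => //.
  have tx : t <= x 0 i by rewrite leNgt; apply/negP => /ltH.
  split=> j; rewrite maxcE; case: eqP => // ->; first by rewrite ge_max cx.
  by rewrite le_max xd.
Qed.

Lemma measurable_le i t : measurable ([set x : 'rV[R]_n | x 0 i <= t] : set
  (lebesgue_space R n)).
Proof. by apply: (@caratheodory_halfspace i t) => // x /= /ltW. Qed.

Lemma measurable_lt i t : measurable ([set x : 'rV[R]_n | x 0 i < t] : set
  (lebesgue_space R n)).
Proof. by apply: (@caratheodory_halfspace i t) => // x /= /ltW. Qed.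

Lemma measurable_forall_ord (F : 'I_n -> set (lebesgue_space R n)) :
  (forall i, measurable (F i)) -> measurable [set x | forall i, F i x].
Proof.
move=> mF; rewrite [X in measurable X](_ : _ = \bigcap_(i in [set: 'I_n]) F i).
  by apply: fin_bigcap_measurable => //; exact: finite_finset.
by apply/seteqP; split=> x Fx i //; exact: Fx.
Qed.

Lemma measurable_box a b : measurable (box a b : set (lebesgue_space R n)).
Proof.
apply: measurableI; apply: measurable_forall_ord => i; last exact: measurable_le.
rewrite [X in measurable X](_ : _ = ~` [set x : 'rV[R]_n | x 0 i < a 0 i]).
  exact: measurableC (measurable_lt _ _).
by apply/seteqP; split=> x /=; rewrite leNgt => /negP.
Qed.

Lemma measurable_hbox a b : measurable (hbox a b : set (lebesgue_space R n)).
Proof.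
apply: measurable_forall_ord => i.
rewrite [X in measurable X](_ : _ = ~` [set x : 'rV[R]_n | x 0 i < a 0 i] `&`
  [set x : 'rV[R]_n | x 0 i < b 0 i]).
  apply: measurableI; last exact: measurable_lt.
  exact: measurableC (measurable_lt _ _).
by apply/seteqP; split=> x /=; [rewrite leNgt => /andP[/negP]|rewrite leNgt =>
  -[/negP -> ->]].
Qed.

End outer_measure.

(** * Vitali's covering theorem *)

Section vitali.
Context {R : realType} {m : nat}.
Local Notation n := m.+1.
Local Notation lam := (@lebesgue_outer R n).
Implicit Types (a b c d x y : 'rV[R]_n) (r : R) (p q : 'rV[R]_n * R).

Definition cube y r : set 'rV[R]_n := box y (y + const_mx r).

Lemma cubeP y r x : cube y r x <-> forall i, y 0 i <= x 0 i <= y 0 i + r.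
Proof.
split=> [[yx xy] i|yxy]; first by rewrite yx; have := xy i; rewrite !mxE.
by split=> i; have /andP[] := yxy i; rewrite ?mxE.
Qed.

Lemma vec_le_cube y r : 0 <= r -> vec_le y (y + const_mx r).
Proof. by move=> r0 i; rewrite !mxE lerDl. Qed.

Lemma box_vol_cube y r : box_vol y (y + const_mx r) = r ^+ n.
Proof.
rewrite /box_vol (eq_bigr (fun=> r)) ?prodr_const ?card_ord// => i _.
by rewrite !mxE addrAC subrr add0r.
Qed.

Lemma cube_dist y r x z i : cube y r x -> cube y r z -> `|x 0 i - z 0 i| <= r.
Proof.
move=> /cubeP/(_ i)/andP[yx xy] /cubeP/(_ i)/andP[yz zy].
by rewrite ler_norml; lra.
Qed.

(** A finite union of closed cubes is closed, so [x] has a positive distance to it, and a cube of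
    smaller side containing [x] cannot reach it. *)
Lemma small_cubes_avoid (s : seq ('rV[R]_n * R)) x :
  ~ (\bigcup_(p in [set` s]) cube p.1 p.2) x ->
  exists2 e : R, 0 < e & forall y r, r < e -> cube y r x ->
    {in s, forall p, cube p.1 p.2 `&` cube y r = set0}.
Proof.
elim: s => [|p s IH] xs; first by exists 1.
have [|e e0 He] := IH; first by move=> [q qs xq]; apply: xs; exists q => //=;
  rewrite in_cons qs orbT.
have [e' e'0 He'] : exists2 e : R, 0 < e & forall y r, r < e -> cube y r x ->
    cube p.1 p.2 `&` cube y r = set0.
  have : ~ cube p.1 p.2 x by move=> xp; apply: xs; exists p => //=;
    rewrite mem_head.
  rewrite cubeP => /existsNP[i /negP]; rewrite negb_and -!ltNge => /orP[xp|px].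
    exists (p.1 0 i - x 0 i); first by rewrite subr_gt0.
    move=> y r re xyr; apply/seteqP; split=> // z [/cubeP/(_ i)/andP[pz _] zyr].
    by have := cube_dist i xyr zyr; rewrite ler_norml; lra.
  exists (x 0 i - (p.1 0 i + p.2)); first by rewrite subr_gt0.
  move=> y r re xyr; apply/seteqP; split=> // z [/cubeP/(_ i)/andP[_ zp] zyr].
  by have := cube_dist i xyr zyr; rewrite ler_norml; lra.
exists (Num.min e e'); first by rewrite lt_min e0.
move=> y r; rewrite lt_min => /andP[re re'] xyr q;
  rewrite in_cons => /predU1P[->|qs].
  exact: He'.
exact: (He y r).
Qed.

Lemma small_cubes_sub a b x : obox a b x ->
  exists2 e : R, 0 < e & forall y r, r < e -> cube y r x ->
    vec_le a y /\ vec_le (y + const_mx r) b.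
Proof.
move=> xab; pose F i := Num.min (x 0 i - a 0 i) (b 0 i - x 0 i).
exists (\big[Num.min/1]_i F i).
  apply: lt_bigmin => // i _; have := xab i; rewrite /F lt_min !subr_gt0; lra.
move=> y r re /cubeP xyr.
have reF i : r < F i by apply: (lt_le_trans re); exact: bigmin_le_cond.
by split=> i; have := reF i; rewrite /F lt_min ?mxE; have := xyr i; lra.
Qed.

Lemma hbox_cube y r : hbox y (y + const_mx r) `<=` cube y r.
Proof. by move=> x xyr; apply/cubeP => i; have := xyr i;
  rewrite !mxE => /andP[-> /ltW]. Qed.

(** A cube is encoded as the pair of its lower corner and its side. The point [x] may lie anywhere
    in the cube. *)
Definition fine_at (V : set ('rV[R]_n * R)) x :=
  forall e, 0 < e -> exists p, [/\ V p, 0 < p.2 < e & cube p.1 p.2 x].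

Definition fine_cover (E : set 'rV[R]_n) (V : set ('rV[R]_n * R)) :=
  forall x, E x -> fine_at V x.

Definition disjoint_family (s : seq ('rV[R]_n * R)) :=
  uniq s /\ {in s &, forall p q, p != q -> cube p.1 p.2 `&` cube q.1 q.2 = set0}.

Lemma superadditive_cubes phi (s : seq ('rV[R]_n * R)) a b :
  cut_additive phi -> nonnegative phi -> vec_le a b -> disjoint_family s ->
  {in s, forall p, [/\ 0 < p.2, vec_le a p.1 & vec_le (p.1 + const_mx p.2) b]} ->
  \sum_(p <- s) phi p.1 (p.1 + const_mx p.2) <= phi a b.
Proof.
move=> phiA phi0 ab [us dis] sab.
apply: (superadditive (c := fst) (d := fun p => p.1 + const_mx p.2)) => //.
  by move=> p /sab[p0 ap pb]; split=> //; exact/vec_le_cube/ltW.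
move=> p q ps qs pq; apply/seteqP; split=> // x [/hbox_cube xp /hbox_cube xq].
by rewrite -(dis _ _ ps qs pq).
Qed.

Lemma nonnegative_box_vol : nonnegative (@box_vol R n).
Proof. by move=> c d /box_vol_ge0. Qed.

(* Banach's greedy selection: pick disjoint cubes, each of side at least half the
   supremum of the sides still available; the 5-fold dilates of a tail cover
     the rest. *)
Lemma vitali (a b : 'rV[R]_n) (E : set 'rV[R]_n) (V : set ('rV[R]_n * R)) (e : R) :
  vec_le a b ->
  (forall p, V p -> [/\ 0 < p.2, vec_le a p.1 & vec_le (p.1 + const_mx p.2) b]) ->
  fine_cover E V -> 0 < e ->
  exists s, [/\ disjoint_family s, {in s, forall p, V p} &
    (lam (E `\` \bigcup_(p in [set` s]) cube p.1 p.2) <= e%:E)%E].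
Proof.
move=> ab Vab EV e0.
pose good s := disjoint_family s /\ {in s, forall p, V p}.
pose cand (s : seq ('rV[R]_n * R)) q := V q /\
  {in s, forall p, cube p.1 p.2 `&` cube q.1 q.2 = set0}.
have fineE s x : E x -> ~ (\bigcup_(p in [set` s]) cube p.1 p.2) x ->
    exists2 q, cand s q & cube q.1 q.2 x.
  move=> Ex /small_cubes_avoid[e1 e10 He1].
  have [q [Vq /andP[q0 qe] qx]] := EV x Ex e1 e10.
  by exists q => //; split=> //; exact: He1 qe qx.
(* If the selection can stop at some [s], then by [fineE] this finite family already covers [E]. *)
have [[s [gs ncs]]|allc] := pselect (exists s, good s /\ ~ exists q, cand s q).
  exists s; split; [exact: gs.1|exact: gs.2|].
  rewrite [X in lam X](_ : _ = set0) ?lebesgue_outer0 ?lee_fin ?ltW//.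
  apply/seteqP; split=> // x [Ex xs]; have [q qs _] := fineE s x Ex xs.
  by apply: ncs; exists q.
have [nx nxP] : {nx : seq ('rV[R]_n * R) -> 'rV[R]_n * R & forall s, good s ->
    cand s (nx s) /\ forall q, cand s q -> q.2 <= 2 * (nx s).2}.
  apply: (@choice _ _ (fun s q0 => good s ->
    cand s q0 /\ forall q, cand s q -> q.2 <= 2 * q0.2)) => s.
  (* The choice only matters on good lists; elsewhere it takes the arbitrary value (0, 0). *)
  have [gs|] := pselect (good s); last by exists (0, 0).
  pose S := [set q.2 | q in cand s].
  have [q0 q0s] : exists q, cand s q.
    by apply: contrapT => nc; apply: allc; exists s.
  have supS : has_sup S.
    split; first by exists q0.2, q0.
    exists (b 0 0 - a 0 0) => _ [q [/Vab[_ aq qb] _] <-].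
    by have := aq 0; have := qb 0; rewrite !mxE; lra.
  have S0 : 0 < sup S.
    apply: (@lt_le_trans _ _ q0.2); first by have [] := Vab _ q0s.1.
    by apply: ub_le_sup; [exact: supS.2|exists q0].
  have [_ [q1 q1s <-] Sq1] := sup_adherent (divr_gt0 S0 (ltr0n R 2)) supS.
  exists q1 => _; split=> // q qs.
  have : q.2 <= sup S by apply: ub_le_sup; [exact: supS.2|exists q].
  by move: Sq1; lra.
pose S k := iter k (fun s => nx s :: s) [::]; pose q k := nx (S k).
have SS k : S k.+1 = q k :: S k by [].
have gS k : good (S k).
  elim: k => [|k [[us dis] sV]]; first by split; first split.
  have [[Vq dq] _] := nxP _ (conj (conj us dis) sV).
  have q0 : 0 < (q k).2 by have [] := Vab _ Vq.
  have qq : cube (q k).1 (q k).2 (q k).1.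
    by apply/cubeP => i; rewrite lexx lerDl ltW.
  rewrite SS; split; last by move=> p; rewrite in_cons => /predU1P[->|/sV].
  split=> [|p1 p2]; rewrite /=.
    rewrite us andbT; apply/negP => /dq /seteqP[/(_ (q k).1) + _].
    by apply.
  rewrite !in_cons => /predU1P[->|p1s] /predU1P[->|p2s].
  - by rewrite eqxx.
  - by rewrite setIC => _; exact: dq.
  - by move=> _; exact: dq.
  - exact: dis.
have qV k : V (q k) by have [[]] := nxP _ (gS k).
have q0 k : 0 < (q k).2 by have [] := Vab _ (qV k).
have memS k p : p \in S k -> exists2 j, (j < k)%N & p = q j.
  elim: k => [//|k IH]; rewrite SS in_cons => /predU1P[->|/IH[j jk ->]].
    by exists k.
  by exists j => //; rewrite ltnS ltnW.
have Smem k j : (j < k)%N -> q j \in S k.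
  elim: k => [//|k IH]; rewrite SS in_cons ltnS leq_eqVlt => /predU1P[->|/IH ->].
    by rewrite eqxx.
  by rewrite orbT.
(* The volumes of the disjoint cubes in [a, b] sum to at most that of [a, b] ([TM]). Hence their
   series has small tails ([tail]), and the sides come arbitrarily close to 0 ([qto0]). *)
pose u k := (q k).2 ^+ n.
have u0 k : 0 <= u k by rewrite exprn_ge0// ltW.
pose T k := \sum_(0 <= j < k) u j.
have TM k : T k <= box_vol a b.
  have := superadditive_cubes cut_additive_box_vol nonnegative_box_vol ab (gS k).1
    (fun p ps => Vab p ((gS k).2 p ps)).
  suff -> : \sum_(p <- S k) box_vol p.1 (p.1 + const_mx p.2) = T k by [].
  elim: k => [|k IH]; first by rewrite big_nil /T big_nil.
  by rewrite SS big_cons /T big_nat_recr//= IH box_vol_cube addrC.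
have tail z : 0 < z -> exists N, forall K, \sum_(N <= j < K) u j <= z.
  move=> z0; have supT : has_sup (range T).
    by split; [exists (T 0%N), 0%N|exists (box_vol a b) => _ [k _ <-]].
  have [_ [N _ <-] TN] := sup_adherent z0 supT; exists N => K.
  have [NK|KN] := leqP N K; last by rewrite big_geq ?ltW// ltnW.
  have : T K <= sup (range T) by apply: ub_le_sup; [exact: supT.2|exists K].
  by rewrite /T (big_cat_nat (n := N))//= -/(T N); lra.
have qto0 z : 0 < z -> exists k, (q k).2 < z.
  move=> z0; have [N /(_ N.+1)] := tail (z ^+ n / 2) (divr_gt0 (exprn_gt0 _ z0)
    (ltr0n R 2)).
  rewrite big_nat1 => uN; exists N; rewrite -(ltr_pXn2r (n := n))// ?nnegrE
    ?(ltW z0) ?ltW//.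
  by apply: (le_lt_trans uN); have := exprn_gt0 n z0; lra.
(* Dilation by 5 multiplies volumes by 5 ^ n, so the dilates of the cubes from [N] on have total
   volume at most [e]. *)
have [N HN] := tail (e / 5 ^+ n) (divr_gt0 e0 (exprn_gt0 _ (ltr0n R 5))).
exists (S N); split; [exact: (gS N).1|exact: (gS N).2|].
(* The cube with the same centre as [q k] and 5 times its side. *)
pose F k := cube ((q k).1 - const_mx (2 * (q k).2)) (5 * (q k).2).
apply: (@le_trans _ _ (lam (\bigcup_(k in ~` `I_N) F k))).
  apply: le_lebesgue_outer => x [Ex xS].
  have [p [Vp pS] xp] := fineE _ x Ex xS.
  (* A cube [p] missing every selected cube would remain a candidate forever, so its side would be
     at most twice that of every [q k], contradicting [qto0]. *)
  have [k pqk] : exists k, `[< cube p.1 p.2 `&` cube (q k).1 (q k).2 !=set0 >].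
    apply: contrapT => nk.
    have pS' k : cand (S k) p.
      split=> // _ /memS[j _ ->]; apply/eqP/negP => /negP/set0P h.
      by apply: nk; exists j; apply/asboolP; rewrite setIC.
    have p0 : 0 < p.2 by have [] := Vab _ Vp.
    have [k] := qto0 (p.2 / 2) (divr_gt0 p0 (ltr0n R 2)).
    by have := (nxP _ (gS k)).2 p (pS' k); rewrite -/(q k); lra.
  have {k pqk} : exists k, `[< cube p.1 p.2 `&` cube (q k).1 (q k).2 !=set0 >]
    by exists k.
  (* For the first [k] such that [q k] meets [p], the cube [p] was still a candidate when [q k] was
     selected. Its side is thus at most twice that of [q k], which puts [p] inside [F k]; and [k] is
     at least [N] because [p] misses [S N]. *)
  move=> exk; case: (ex_minnP exk) => k /asboolP[z [zp zq]] kmin.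
  have pSk : cand (S k) p.
    split=> // _ /memS[j jk ->]; apply/eqP/negP => /negP/set0P h.
    by have := kmin j; rewrite setIC in h; move=> /(_ (asboolT h));
      rewrite leqNgt jk.
  have pq : p.2 <= 2 * (q k).2 by exact: (nxP _ (gS k)).2.
  exists k.
    rewrite /= ; apply/negP; rewrite -leqNgt leqNgt; apply/negP => kN.
    have /seteqP[/(_ z) + _] := pS _ (Smem _ _ kN).
    by apply.
  apply/cubeP => i; have := cube_dist i xp zp.
  move/cubeP : zq => /(_ i); rewrite ler_norml !mxE; have := q0 k; move: pq; lra.
apply: (le_trans (outer_measure_sigma_subadditive_tail
  (lam : {outer_measure set _ -> \bar R}) N F)).
apply: lime_le.
  by apply: is_cvg_nneseries => k _ _; exact: lebesgue_outer_ge0.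
apply: nearW => K; apply: (@le_trans _ _ (\sum_(N <= k < K) (5 ^+ n * u k)%:E)).
  apply: lee_sum => k _; rewrite -exprMn -(box_vol_cube ((q k).1 - const_mx (2
    * (q k).2))).
  by apply/lebesgue_outer_box/vec_le_cube; rewrite mulr_ge0// ltW.
rewrite sumEFin lee_fin -mulr_sumr mulrC -ler_pdivlMr ?exprn_gt0//.
Qed.

Lemma lebesgue_outer_bigcup_seq (I : eqType) (s : seq I) (F : I -> set 'rV[R]_n) :
  (lam (\bigcup_(j in [set` s]) F j) <= \sum_(j <- s) lam (F j))%E.
Proof.
elim: s => [|j s IH].
  by rewrite big_nil bigcup0 ?lebesgue_outer0.
rewrite big_cons; apply: (@le_trans _ _ (lam (F j `|` \bigcup_(j in [set` s]) F
  j))).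
  apply: le_lebesgue_outer => x [k /=]; rewrite in_cons => /predU1P[->|ks] Fk.
    by left.
  by right; exists k.
by apply: (le_trans (lebesgue_outer_setU _ _)); exact: leeD2l.
Qed.

(** Up to outer measure [e], finitely many disjoint cubes of the family cover [E]. The local bounds
    are added over them, and superadditivity bounds the sum by [C * phi a b]. *)
Lemma vitali_bound phi (C : R) a b (E : set 'rV[R]_n) :
  cut_additive phi -> nonnegative phi -> 0 <= C -> vec_le a b -> E `<=` obox a b ->
  fine_cover E [set p |
    (lam (E `&` cube p.1 p.2) <= (C * phi p.1 (p.1 + const_mx p.2))%:E)%E] ->
  (lam E <= (C * phi a b)%:E)%E.
Proof.
move=> phiA phi0 C0 ab Eab fE; set V := (X in fine_cover _ X) in fE.
(* All sufficiently small cubes containing a point of the open box lie in [a, b], so discarding the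
   other cubes keeps the cover fine. *)
pose V' := V `&` [set p | [/\ 0 < p.2, vec_le a p.1 & vec_le (p.1 + const_mx
  p.2) b]].
have fE' : fine_cover E V'.
  move=> x Ex e e0; have [e' e'0 He'] := small_cubes_sub (Eab _ Ex).
  have [|p [Vp /andP[p0]]] := fE x Ex (Num.min e e'); first by rewrite lt_min e0.
  rewrite lt_min => /andP[pe pe'] px; have [ap pb] := He' _ _ pe' px.
  by exists p; split=> //; rewrite p0.
apply/lee_addgt0Pr => e e0.
have [s [ds sV sE]] := vitali ab (fun p => @proj2 _ _) fE' e0.
rewrite -(setUIDK E (\bigcup_(p in [set` s]) cube p.1 p.2)).
apply: (le_trans (lebesgue_outer_setU _ _)); apply: leeD => //.
rewrite setI_bigcupr; apply: (le_trans (lebesgue_outer_bigcup_seq _ _)).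
apply: (@le_trans _ _ (\sum_(p <- s) (C * phi p.1 (p.1 + const_mx p.2))%:E)%E).
  by rewrite big_seq [leRHS]big_seq; apply: lee_sum => p /sV[].
rewrite sumEFin lee_fin -mulr_sumr ler_wpM2l//.
by apply: superadditive_cubes => // p /sV[].
Qed.

End vitali.

(** * Differentiation of interval functions along cubes *)

Section cube_derivative.
Context {R : realType} {m : nat}.
Local Notation n := m.+1.
Local Notation lam := (@lebesgue_outer R n).
Implicit Types (a b c d x y : 'rV[R]_n) (E : set 'rV[R]_n) (e r : R).
Variable phi : 'rV[R]_n -> 'rV[R]_n -> R.
Hypotheses (phiA : cut_additive phi) (phi0 : nonnegative phi).

Lemma not_fine_at (V : set ('rV[R]_n * R)) x : ~ fine_at V x ->
  exists2 e, 0 < e & forall y r, 0 < r < e -> cube y r x -> ~ V (y, r).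
Proof.
move=> /existsNP[e /not_implyP[e0 ne]]; exists e => // y r re xyr Vyr.
by apply: ne; exists (y, r).
Qed.

Definition low_cubes (p : R) : set ('rV[R]_n * R) :=
  [set c | phi c.1 (c.1 + const_mx c.2) <= p * c.2 ^+ n].

Definition high_cubes (q : R) : set ('rV[R]_n * R) :=
  [set c | q * c.2 ^+ n <= phi c.1 (c.1 + const_mx c.2)].

(** On a high cube Q, lam(E & Q) <= vol(Q) <= phi(Q) / q, which is the local bound of
    [vitali_bound]. *)
Lemma lebesgue_outer_high a b E (q : R) : 0 < q -> vec_le a b -> E `<=` obox a b ->
  fine_cover E (high_cubes q) -> (lam E <= (q^-1 * phi a b)%:E)%E.
Proof.
move=> q0 ab Eab fE; apply: vitali_bound => //; first by rewrite invr_ge0 ltW.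
move=> x Ex e e0; have [p [Vp /andP[p0 pe] xp]] := fE x Ex e e0.
exists p; split; [|by rewrite p0|exact: xp].
apply: (@le_trans _ _ (lam (cube p.1 p.2))).
  by apply: le_lebesgue_outer; exact: subIsetr.
apply: (le_trans (lebesgue_outer_box (vec_le_cube _ (ltW p0)))).
by rewrite box_vol_cube lee_fin mulrC ler_pdivlMr// mulrC.
Qed.

(** Here [vitali_bound] is applied to the volume and the low cubes: inside a low cube Q,
    [lebesgue_outer_high] gives lam(E & Q) <= phi(Q) / q <= (p / q) vol(Q). *)
Lemma lebesgue_outer_low_high a b E (p q : R) :
  0 <= p -> 0 < q -> vec_le a b -> E `<=` obox a b ->
  fine_cover E (low_cubes p) -> fine_cover E (high_cubes q) ->
  (lam E <= (p / q * box_vol a b)%:E)%E.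
Proof.
move=> p0 q0 ab Eab fEp fEq.
apply: vitali_bound => //; [exact: cut_additive_box_vol|exact: nonnegative_box_vol|
  by rewrite divr_ge0// ltW|].
move=> x Ex e e0; have [c [Vc /andP[c0 ce] xc]] := fEp x Ex e e0.
exists c; split; [|by rewrite c0|exact: xc].
set Q := cube c.1 c.2; pose Qo := obox c.1 (c.1 + const_mx c.2).
have cQ : vec_le c.1 (c.1 + const_mx c.2) by exact/vec_le_cube/ltW.
(* [lebesgue_outer_high] asks for a subset of an open box, so the boundary of Q, a null set, is
   split off. *)
apply: (@le_trans _ _ (lam ((E `&` Qo) `|` (Q `\` Qo)))).
  apply: le_lebesgue_outer => z [Ez Qz].
  by have [zo|zo] := pselect (Qo z); [left|right].
apply: (le_trans (lebesgue_outer_setU _ _)).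
rewrite lebesgue_outer_boundary// adde0.
have fEQ : fine_cover (E `&` Qo) (high_cubes q) by move=> z [/fEq].
apply: (le_trans (lebesgue_outer_high q0 cQ (@subIsetr _ _ _) fEQ)).
by rewrite lee_fin box_vol_cube [p / q]mulrC -mulrA ler_wpM2l// invr_ge0 ltW.
Qed.

(* Summing the hypothesis over a cover by boxes, whose boundaries are null, gives
   lam E <= k lam E. *)
Lemma lebesgue_outer_contraction E (k : R) : 0 <= k < 1 -> (lam E < +oo)%E ->
  (forall c d, vec_le c d -> (lam (E `&` obox c d) <= (k * box_vol c d)%:E)%E) ->
  lam E = 0%E.
Proof.
move=> /andP[k0 k1] Eoo H.
have Efin : lam E \is a fin_num by rewrite ge0_fin_numE ?lebesgue_outer_ge0.
have main e : 0 < e -> fine (lam E) <= k * (fine (lam E) + e).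
  move=> e0.
  have [_ [I [c [d [[cd EI] ->]]]] lt] := lb_ereal_inf_adherent e0 Efin.
  pose v j := if j \in I then (box_vol (c j) (d j))%:E else 0%E : \bar R.
  have v0 j : (0 <= v j)%E.
    by rewrite /v; case: ifPn => // /set_mem /cd /box_vol_ge0; rewrite lee_fin.
  pose F j := if j \in I then E `&` obox (c j) (d j) else set0.
  pose G j := if j \in I then box (c j) (d j) `\` obox (c j) (d j) else set0.
  have : (lam E <= k%:E * \esum_(j in I) (box_vol (c j) (d j))%:E)%E.
    apply: (@le_trans _ _ (lam (\bigcup_j F j `|` \bigcup_j G j))).
      apply: le_lebesgue_outer => x Ex; have [j Ij xj] := EI x Ex.
      have [xo|xo] := pselect (obox (c j) (d j) x).
        by left; exists j => //; rewrite /F mem_set.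
      by right; exists j => //; rewrite /G mem_set.
    apply: (le_trans (lebesgue_outer_setU _ _)).
    rewrite (lebesgue_outer_bigcup0 (F := G)) ?adde0; last first.
      move=> j; rewrite /G; case: ifPn => [/set_mem /cd cdj|_].
        exact: lebesgue_outer_boundary.
      exact: lebesgue_outer0.
    apply: (le_trans (lebesgue_outer_sigma_subadditive F)).
    rewrite esum_mkcond -(nneseries_esumT v0) -nneseriesZl; last by move=> j _;
      exact: v0.
    apply: lee_nneseries => [j _ _|j _]; first exact: lebesgue_outer_ge0.
    rewrite /F /v; case: ifPn => [/set_mem /cd cdj|_]; first by rewrite -EFinM H.
    by rewrite lebesgue_outer0 mule0.
  move=> le1.
  have : (lam E <= k%:E * (lam E + e%:E))%E.
    apply: le_trans le1 _.
    by rewrite lee_wpmul2l ?lee_fin// ltW.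
  by rewrite -(fineK Efin) -EFinD -EFinM lee_fin.
have E0 : 0 <= fine (lam E) by rewrite fine_ge0// lebesgue_outer_ge0.
rewrite -(fineK Efin); congr (_%:E); apply/eqP; rewrite eq_le E0 andbT leNgt.
apply/negP => Epos; set z := fine _ in main E0 Epos.
(* With e = (1 - k) z, [main] reads z <= k (2 - k) z = (1 - (1 - k)^2) z, impossible for z > 0. *)
have := main ((1 - k) * z) (mulr_gt0 _ Epos); rewrite subr_gt0 => /(_ k1).
have : 0 < (1 - k) * z by rewrite mulr_gt0// subr_gt0.
have : 0 < (1 - k) * ((1 - k) * z) by rewrite !mulr_gt0// subr_gt0.
nra.
Qed.

(** The limit is over all small cubes containing [x]. It thus applies both to cubes with lower
    corner [x], as in the joint derivative, and to grid cells, where the position of [x] varies. *)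
Definition has_cube_derivative x (l : R) := forall e, 0 < e ->
  exists2 e', 0 < e' & forall y r, 0 < r < e' -> cube y r x ->
    `|phi y (y + const_mx r) / r ^+ n - l| <= e.

Lemma cube_self x (r : R) : 0 <= r -> cube x r x.
Proof. by move=> r0; apply/cubeP => i; rewrite lexx lerDl. Qed.

(* The derivative is the supremum of the p such that phi >= p vol on all small
   cubes containing x. *)
Lemma cube_derivative_exists x (q0 : R) : ~ fine_at (high_cubes q0) x ->
  (forall p q : rat, 0 < ratr p :> R -> p < q -> fine_at (low_cubes (ratr p)) x ->
    ~ fine_at (high_cubes (ratr q)) x) ->
  exists l, has_cube_derivative x l.
Proof.
move=> nq0 npq.
pose S := [set p : R | 0 <= p /\ exists2 e, 0 < e & forall y r, 0 < r < e ->
  cube y r x -> p * r ^+ n <= phi y (y + const_mx r)].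
have S0 : S 0.
  split=> //; exists 1 => // y r /andP[r0 _] _; rewrite mul0r.
  exact/phi0/vec_le_cube/ltW.
have supS : has_sup S.
  split; first by exists 0.
  have [e1 e10 H1] := not_fine_at nq0.
  exists q0 => p [_ [e2 e20 H2]].
  pose r := Num.min e1 e2 / 2.
  have r0 : 0 < r by rewrite divr_gt0// lt_min e10.
  have re : r < Num.min e1 e2 by rewrite /r; move: r0; rewrite /r; lra.
  move: re; rewrite lt_min => /andP[re1 re2].
  have xr := cube_self x (ltW r0).
  rewrite leNgt; apply/negP => q0p.
  apply: (H1 x r _ xr); first by rewrite r0.
  apply: le_trans (H2 x r _ xr); last by rewrite r0.
  by rewrite /= ler_wpM2r ?exprn_ge0// ltW.
have l0 : 0 <= sup S by apply: ub_le_sup; [exact: supS.2|].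
exists (sup S) => e e0.
have [p [_ [e1 e10 H1]] lep] := sup_adherent e0 supS.
have le' : sup S < sup S + e by rewrite ltrDl.
(* Rationals are chosen with sup S < p' < q < sup S + e. As [p'] is not in [S], low cubes for [p']
   are fine at [x]; by hypothesis high cubes for [q] are then not fine at [x], which bounds the
   quotients above by [q]. *)
have [q] := rat_in_itvoo le'; rewrite in_itv /= => /andP[lq qe].
have [p'] := rat_in_itvoo lq; rewrite in_itv /= => /andP[lp p'q].
have p'0 : 0 < ratr p' :> R by exact: le_lt_trans lp.
have np' : ~ S (ratr p').
  by move=> Sp'; move: lp; rewrite ltNge => /negP; apply; apply: ub_le_sup;
    [exact: supS.2|].
have lowp' : fine_at (low_cubes (ratr p')) x.
  move=> e2 e20; apply: contrapT => nlow; apply: np'; split; first exact: ltW.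
  exists e2 => // y r re2 xyr; rewrite leNgt; apply/negP => /ltW lt.
  by apply: nlow; exists (y, r).
have p'q' : p' < q by rewrite -(ltr_rat R).
have [e3 e30 H3] := not_fine_at (npq _ _ p'0 p'q' lowp').
exists (Num.min e1 e3); first by rewrite lt_min e10.
move=> y r /andP[r0]; rewrite lt_min => /andP[re1 re3] xyr.
have := H1 y r _ xyr; rewrite r0 => /(_ re1) pphi.
have := H3 y r _ xyr; rewrite r0 => /(_ re3) /negP; rewrite /= -ltNge => phiq.
have rn0 : 0 < r ^+ n by rewrite exprn_gt0.
rewrite ler_distl; apply/andP; split.
  by rewrite ler_pdivlMr//; apply: le_trans pphi; rewrite ler_wpM2r// ltW.
by rewrite ler_pdivrMr//; apply: (le_trans (ltW phiq)); rewrite ler_wpM2r// ltW.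
Qed.

(** By [cube_derivative_exists], every exceptional point lies in [Einf] or in some [Epq]. Rational
    thresholds make this a countable union of null sets. *)
Lemma cube_derivative_ae a b : vec_le a b ->
  lam (obox a b `&` [set x | ~ exists l, has_cube_derivative x l]) = 0%E.
Proof.
move=> ab.
have boxoo E : E `<=` obox a b -> (lam E < +oo)%E.
  move=> Eab; apply: (@le_lt_trans _ _ (lam (box a b))).
    apply: le_lebesgue_outer => x /Eab xab.
    by split=> i; have /andP[/ltW ? /ltW] := xab i.
  by apply: (le_lt_trans (lebesgue_outer_box ab)); rewrite ltry.
pose Einf := obox a b `&` [set x | forall k : nat, fine_at (high_cubes k.+1%:R) x].
pose Epq (pq : rat * rat) := obox a b `&` [set x |
  [/\ 0 < ratr pq.1 :> R, pq.1 < pq.2, fine_at (low_cubes (ratr pq.1)) x &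
      fine_at (high_cubes (ratr pq.2)) x]].
have Einf0 : lam Einf = 0%E.
  have Einfb : Einf `<=` obox a b by exact: subIsetl.
  have Efin : lam Einf \is a fin_num.
    by rewrite ge0_fin_numE ?lebesgue_outer_ge0// boxoo.
  rewrite -(fineK Efin); congr (_%:E); apply/eqP.
  rewrite eq_le fine_ge0 ?lebesgue_outer_ge0// andbT leNgt; apply/negP => E0.
  (* The bound for every [k] forces lam(Einf) = 0 by the Archimedean property. *)
  have main (k : nat) : fine (lam Einf) * k.+1%:R <= phi a b.
    have : fine_cover Einf (high_cubes k.+1%:R) by move=> x [_ /(_ k)].
    move=> /(lebesgue_outer_high (ltr0Sn R k) ab Einfb).
    by rewrite -(fineK Efin) lee_fin mulrC ler_pdivlMr.
  have := archi_boundP (divr_ge0 (phi0 ab) (ltW E0)).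
  set k := Num.bound _; rewrite ltr_pdivrMr// => lt.
  have := main k; rewrite -natr1 mulrDr mulr1; move: lt; rewrite mulrC; lra.
have Epq0 pq : lam (Epq pq) = 0%E.
  have [[p0 pq1]|npq] := pselect (0 < ratr pq.1 :> R /\ pq.1 < pq.2); last first.
    rewrite [Epq pq](_ : _ = set0) ?lebesgue_outer0//.
    by apply/seteqP; split=> // x [_ [p0 pq1 _ _]]; apply: npq.
  have q0 : 0 < ratr pq.2 :> R by rewrite (lt_trans p0)// ltr_rat.
  apply: (@lebesgue_outer_contraction _ (ratr pq.1 / ratr pq.2)).
  - by rewrite divr_ge0 ?ltW// ltr_pdivrMr// mul1r ltr_rat.
  - by apply: boxoo; exact: subIsetl.
  - move=> c d cd; apply: lebesgue_outer_low_high => //; first exact: ltW.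
    + by move=> x [[_ []]].
    + by move=> x [[_ []]].
apply: lebesgue_outer_eq0.
apply: (@le_trans _ _ (lam (Einf `|` \bigcup_pq Epq pq))).
  apply: le_lebesgue_outer => x [xab nl].
  have [xinf|/existsNP[k nk]] :=
    pselect (forall k : nat, fine_at (high_cubes k.+1%:R) x); first by left.
  right; apply: contrapT => npq; apply: nl.
  apply: (cube_derivative_exists nk) => p q p0 pq lowp highq.
  by apply: npq; exists (p, q).
apply: (le_trans (lebesgue_outer_setU _ _)).
by rewrite Einf0 (lebesgue_outer_bigcup0 Epq0) adde0.
Qed.

End cube_derivative.

(** * Integral of the derivative *)

Section grid.
Context {R : realType} {m : nat}.
Local Notation n := m.+1.
Local Notation mu := (@lebesgue_measure_rV R n).
Implicit Types (x : 'rV[R]_n) (k : nat).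
Variables (phi : 'rV[R]_n -> 'rV[R]_n -> R) (a : 'rV[R]_n) (L : R).
Hypotheses (phiA : cut_additive phi) (phi0 : nonnegative phi) (L0 : 0 < L).

(** The grid subdivides the cube of side [L] with lower corner [a], rather than [a, b], so that its
    cells are cubes. There are [k.+1] cells along each side, hence no division by 0. *)
Definition mesh k : R := L / k.+1%:R.

Definition grid_corner k (z : {ffun 'I_n -> 'I_k.+1}) : 'rV[R]_n :=
  \row_i (a 0 i + mesh k * (z i)%:R).

Definition grid_cell k (z : {ffun 'I_n -> 'I_k.+1}) : set 'rV[R]_n :=
  hbox (grid_corner z) (grid_corner z + const_mx (mesh k)).

Definition grid_density k (z : {ffun 'I_n -> 'I_k.+1}) : R :=
  phi (grid_corner z) (grid_corner z + const_mx (mesh k)) / mesh k ^+ n.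

Definition grid_step k x : R :=
  \sum_(z : {ffun 'I_n -> 'I_k.+1}) grid_density z * \1_(grid_cell z) x.

Lemma mesh_gt0 k : 0 < mesh k.
Proof. by rewrite divr_gt0. Qed.

Lemma grid_density_ge0 k (z : {ffun 'I_n -> 'I_k.+1}) : 0 <= grid_density z.
Proof.
rewrite divr_ge0 ?exprn_ge0 ?(ltW (mesh_gt0 _))//.
exact/phi0/vec_le_cube/ltW/mesh_gt0.
Qed.

Lemma grid_step_ge0 k x : 0 <= grid_step k x.
Proof. by apply: sumr_ge0 => z _; rewrite mulr_ge0 ?grid_density_ge0// indicE
  ler0n. Qed.

Lemma grid_cell_inj k (z z' : {ffun 'I_n -> 'I_k.+1}) x :
  grid_cell z x -> grid_cell z' x -> z = z'.
Proof.
have h0 := mesh_gt0 k.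
have le (z1 z2 : {ffun 'I_n -> 'I_k.+1}) i :
    grid_cell z1 x -> grid_cell z2 x -> (z1 i <= z2 i)%N.
  move=> /(_ i)/andP[+ _] /(_ i)/andP[_]; rewrite !mxE => lt2 le1.
  rewrite -ltnS -(ltr_nat R) -natr1 -(ltr_pM2l h0) mulrDr mulr1.
  by apply: le_lt_trans (_ : x 0 i - a 0 i < _); move: le1 lt2; lra.
move=> xz xz'; apply/ffunP => i; apply/val_inj/eqP.
by rewrite /= eqn_leq !le.
Qed.

Lemma grid_cell_cover k x : hbox a (a + const_mx L) x ->
  exists z : {ffun 'I_n -> 'I_k.+1}, grid_cell z x.
Proof.
move=> xaL; have h0 := mesh_gt0 k.
have t0 i : 0 <= (x 0 i - a 0 i) / mesh k.
  by rewrite divr_ge0 ?subr_ge0 ?(ltW h0)//; have /andP[] := xaL i.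
(* The truncation is below [k.+1] because x_i < a_i + L, so [inord] does not alter it. *)
exists [ffun i => inord (Num.truncn ((x 0 i - a 0 i) / mesh k))] => i.
rewrite !mxE ffunE inordK; last first.
  rewrite truncn_lt_nat// ltr_pdivrMr// /mesh mulrC divfK ?pnatr_eq0//.
  by have := xaL i; rewrite !mxE; lra.
have := truncnS_gt ((x 0 i - a 0 i) / mesh k); have := t0 i; rewrite -truncn_le.
rewrite ler_pdivlMr// ltr_pdivrMr// -natr1; lra.
Qed.

Lemma grid_stepE k x (z : {ffun 'I_n -> 'I_k.+1}) :
  grid_cell z x -> grid_step k x = grid_density z.
Proof.
move=> xz; rewrite /grid_step (bigD1 z)//= big1 ?addr0; last first.
  move=> z' z'z; rewrite indicE memNset ?mulr0// => xz'.
  by move/eqP : z'z; apply; exact: grid_cell_inj xz' xz.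
by rewrite indicE mem_set ?mulr1.
Qed.

(** The cell containing [x] is a cube whose side tends to 0. *)
Lemma cvg_grid_step x l : hbox a (a + const_mx L) x -> has_cube_derivative phi
  x l ->
  grid_step k x @[k --> \oo] --> l.
Proof.
move=> xaL xl; apply/cvgrPdist_le => e e0.
have [e' e'0 He'] := xl e e0.
have eL : 0 < e' / L by rewrite divr_gt0.
near=> k.
have [z xz] := grid_cell_cover k xaL.
rewrite (grid_stepE xz) distrC; apply: He'; last exact: hbox_cube.
rewrite mesh_gt0/= /mesh mulrC -ltr_pdivlMr//.
by near: k; exact: (near_infty_natSinv_lt (PosNum eL)).
Unshelve. all: by end_near. Qed.

Lemma measurable_grid_cell k (z : {ffun 'I_n -> 'I_k.+1}) :
  measurable (grid_cell z : set (lebesgue_space R n)).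
Proof. exact: measurable_hbox. Qed.

Lemma measurable_grid_step k (D : set (lebesgue_space R n)) :
  measurable_fun D (fun x : lebesgue_space R n => (grid_step k x)%:E).
Proof.
rewrite (_ : (fun _ => _) = fun x : lebesgue_space R n =>
    (\sum_(z : {ffun 'I_n -> 'I_k.+1}) (grid_density z)%:E * (\1_(grid_cell z)
      x)%:E)%E).
  apply: emeasurable_sum => z; apply: measurable_funeM; apply/measurable_EFinP.
  exact/measurable_indic/measurable_grid_cell.
by apply/funext => x; rewrite /grid_step -sumEFin; apply: eq_bigr => z _;
  rewrite EFinM.
Qed.

(** Each cell contributes at most its density times its volume, which is [phi] of the cell; the
    cells are disjoint, so superadditivity bounds the sum. *)
Lemma integral_grid_step k (D : set (lebesgue_space R n)) : measurable D ->
  (\int[mu]_(x in D) (grid_step k x)%:E <= (phi a (a + const_mx L))%:E)%E.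
Proof.
move=> mD.
have h0 := mesh_gt0 k.
under eq_integral do rewrite /grid_step -sumEFin.
have mI (z : {ffun 'I_n -> 'I_k.+1}) : measurable_fun D
    (fun x : lebesgue_space R n => (\1_(grid_cell z) x)%:E : \bar R).
  by apply/measurable_EFinP; exact/measurable_indic/measurable_grid_cell.
rewrite ge0_integral_sum//; last 2 first.
- by move=> z; under eq_fun do rewrite EFinM; exact: measurable_funeM.
- by move=> z x _; rewrite lee_fin mulr_ge0 ?grid_density_ge0// indicE ler0n.
apply: (@le_trans _ _ (\sum_(z : {ffun 'I_n -> 'I_k.+1})
    (phi (grid_corner z) (grid_corner z + const_mx (mesh k)))%:E)%E).
  apply: lee_sum => z _.
  under eq_integral do rewrite EFinM.
  rewrite ge0_integralZl_EFin ?grid_density_ge0//.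
  rewrite integral_indic//; last exact: measurable_grid_cell.
  apply: (@le_trans _ _ ((grid_density z)%:E * (mesh k ^+ n)%:E)%E); last first.
    by rewrite -EFinM lee_fin divfK ?gt_eqF ?exprn_gt0.
  rewrite lee_wpmul2l ?lee_fin ?grid_density_ge0//.
  rewrite -(box_vol_cube (grid_corner z)).
  apply: le_trans (lebesgue_outer_box (vec_le_cube _ (ltW h0))).
  by apply: le_lebesgue_outer => x [/hbox_cube].
rewrite sumEFin lee_fin; apply: superadditive => //.
- exact/vec_le_cube/ltW.
- exact: index_enum_uniq.
- move=> z _; split; first by move=> i; rewrite mxE lerDl mulr_ge0// ltW.
    exact/vec_le_cube/ltW.
  move=> i; rewrite !mxE -addrA lerD2l -{2}[mesh k]mulr1 -mulrDr natr1.
  by rewrite -ler_pdivlMl// /mesh invf_div divfK ?gt_eqF// ler_nat.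
- move=> z z' _ _ zz'; apply/seteqP; split=> // x [xz xz'].
  by move/eqP : zz'; apply; exact: grid_cell_inj xz xz'.
Qed.

End grid.

(** * Null sets and completeness of Lebesgue measure *)

Section lebesgue_null.
Context {R : realType} {n : nat}.

Lemma lebesgue_measure_complete : measure_is_complete (@lebesgue_measure_rV R n).
Proof. exact: measure_is_complete_caratheodory. Qed.

(** A set of outer measure 0 is Caratheodory measurable, so [N] itself witnesses negligibility. *)
Lemma lebesgue_outer_ae (N : set 'rV[R]_n) (P : 'rV[R]_n -> Prop) :
  lebesgue_outer N = 0%E -> (forall x, ~ N x -> P x) ->
  {ae @lebesgue_measure_rV R n, forall x, P x}.
Proof.
move=> N0 NP; exists N; split=> //; last first.
  by move=> x /= nP; apply: contrapT => /NP.
apply: (le_caratheodory_measurable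
  (mu := @lebesgue_outer R n : {outer_measure set _ -> \bar R})) => X.
rewrite -[leRHS]add0e; apply: leeD.
  by rewrite -N0; apply: le_lebesgue_outer; exact: subIsetr.
by apply: le_lebesgue_outer; exact: subIsetl.
Qed.

End lebesgue_null.

(** * Projection onto the box *)

Section clamp.
Context {R : realType} {n : nat}.
Implicit Types (a b c d x : 'rV[R]_n).
Variables a b : 'rV[R]_n.
Hypothesis ab : vec_le a b.

Definition clamp x : 'rV[R]_n := \row_i Num.max (a 0 i) (Num.min (x 0 i) (b 0 i)).

Lemma clamp_box x : box a b (clamp x).
Proof.
by split=> i; rewrite mxE ?le_max ?lexx// ge_max ge_min lexx orbT andbT; exact: ab.
Qed.

Lemma clamp_id x : box a b x -> clamp x = x.
Proof. by move=> [ax xb]; apply/rowP => i; rewrite mxE min_l// max_r. Qed.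

Lemma clamp_ge x : vec_le b x -> clamp x = b.
Proof. by move=> bx; apply/rowP => i; rewrite mxE min_r// max_r//; exact: ab. Qed.

Lemma vec_le_clamp c d : vec_le c d -> vec_le (clamp c) (clamp d).
Proof. by move=> cd i; rewrite !mxE le_max2// le_min2. Qed.

(** The projection acts coordinatewise, so a cut at [t] becomes a cut at the projected value, and
    cut additivity survives. *)
Lemma clamp_setc x i t :
  clamp (setc x i t) = setc (clamp x) i (Num.max (a 0 i) (Num.min t (b 0 i))).
Proof. by apply/rowP => j; rewrite !mxE; case: eqP => [->|]. Qed.

Lemma cut_additive_clamp phi : cut_additive phi ->
  cut_additive (fun c d => phi (clamp c) (clamp d)).
Proof. by move=> phiA c d i t /=; rewrite !clamp_setc; exact: phiA. Qed.

End clamp.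

(** * From cube derivatives to joint derivatives *)

Section joint_derivative.
Context {R : realType} {m : nat}.
Local Notation n := m.+1.
Implicit Types (a b x : 'rV[R]_n) (f : 'rV[R]_n -> R).

Lemma has_joint_derivative_unique (D : set 'rV[R]_n) f x (l : R) :
  has_joint_derivative D f x l -> joint_derivative D f x = l.
Proof.
move=> xl; apply: xget_unique => // l' [_ xl'].
by apply: (cvg_unique (@Rhausdorff R)) xl' xl.2.
Qed.

(** The default value 0 is nonnegative. Elsewhere [a, b] is a neighborhood of [x], so for small [h]
    the quotients are those of boxes inside [a, b]. *)
Lemma joint_derivative_ge0 a b f x :
  jointly_monotone a b f -> 0 <= joint_derivative (box a b) f x.
Proof.
move=> fab; rewrite /joint_derivative; case: xgetP => // l _ [xab xl].
apply: (cvgr_to_ge xl).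
have [e /= e0 xe] := (nbhs_ballP _ _).1 xab.
near=> h.
have h0 : 0 < h by near: h; exact: nbhs_right_gt.
rewrite divr_ge0 ?exprn_ge0 ?(ltW h0)//; apply: fab.
- exact/xe/ballxx.
- apply: xe; split=> // i j; rewrite /ball/= !mxE ord1 opprD addrA subrr sub0r
    normrN (gtr0_norm h0).
  by near: h; exact: nbhs_right_lt.
- exact/vec_le_cube/ltW.
Unshelve. all: by end_near. Qed.

(** Small cubes with lower corner [x] lie in [a, b], where clamping changes nothing. *)
Lemma has_cube_joint_derivative a b f x (l : R) : vec_le a b -> obox a b x ->
  has_cube_derivative (fun c d => joint_increment f (clamp a b c) (clamp a b
    d)) x l ->
  has_joint_derivative (box a b) f x l.
Proof.
move=> ab xab xl; have [e e0 xe] := small_cubes_sub xab.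
have boxx : box a b x by split=> i; have /andP[/ltW ? /ltW] := xab i.
split.
  apply/nbhs_ballP; exists (e / 4) => /=; first by rewrite divr_gt0.
  move=> y [_ xy].
  (* The cube of side e / 2 centred at [x] lies in [a, b] and contains the ball of radius e / 4. *)
  have sub := xe (x - const_mx (e / 4)) (e / 2).
  have [||ac db] := sub.
  - by lra.
  - by apply/cubeP => i; rewrite !mxE; lra.
  split=> i; have := xy 0 i; rewrite /ball/= ltr_norml => xyi.
  - by have := ac i; rewrite !mxE; lra.
  - by have := db i; rewrite !mxE; lra.
apply/cvgrPdist_le => d d0; have [e' e'0 xe'] := xl d d0.
near=> h.
have h0 : 0 < h by near: h; exact: nbhs_right_gt.
have he : h < e by near: h; exact: nbhs_right_lt.
have he' : h < e' by near: h; exact: nbhs_right_lt.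
have xh := cube_self x (ltW h0).
have [_ xhb] := xe x h he xh.
have := xe' x h; rewrite h0 => /(_ he' xh).
rewrite distrC clamp_id// clamp_id//; split=> //.
exact: vec_le_trans boxx.1 (vec_le_cube _ (ltW h0)).
Unshelve. all: by end_near. Qed.

End joint_derivative.

(** * Almost everywhere existence and the integral inequality *)

Unset Implicit Arguments.

Theorem theorem1p1 (R : realType) (n : nat) (a b : 'rV[R]_n)
    (f : 'rV[R]_n -> R) :
  (1 <= n)%N ->
  (forall i, a 0 i < b 0 i) ->
  jointly_monotone a b f ->
  [/\ {ae @lebesgue_measure_rV R n,
         forall x, box a b x -> joint_derivable (box a b) f x},
      measurable_fun (box a b : set (lebesgue_space R n))
        (joint_derivative (box a b) f) &
      (\int[@lebesgue_measure_rV R n]_(x in box a b)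
          (joint_derivative (box a b) f x)%:E
        <= (joint_increment f a b)%:E)%E].
Proof.
case: n a b f => [//|m] a b f _ ab fab.
have ab' : vec_le a b by move=> i; exact/ltW.
pose phi c d := joint_increment f (clamp a b c) (clamp a b d).
have phiA : cut_additive phi := cut_additive_clamp _ _
  (cut_additive_joint_increment f).
have phi0 : nonnegative phi.
  by move=> c d cd; apply: fab; [exact: clamp_box|exact: clamp_box|exact:
    vec_le_clamp].
(* [L] bounds every side of [a, b], so the cube of side [L] at [a] contains [a, b], and its upper
   corner is clamped to [b]. *)
pose L := \sum_(i < m.+1) (b 0 i - a 0 i).
have leL i : b 0 i - a 0 i <= L.
  by rewrite /L (bigD1 i)//= lerDl sumr_ge0// => j _; rewrite subr_ge0.
have L0 : 0 < L by apply: lt_le_trans (leL 0); rewrite subr_gt0.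
have phiL : phi a (a + const_mx L) = joint_increment f a b.
  rewrite /phi clamp_id; last by split.
  rewrite clamp_ge// => i; have := leL i; rewrite !mxE; lra.
(* Boundary points are exceptional too, since [a, b] is not a neighborhood of them. *)
pose N := (box a b `\` obox a b) `|`
  (obox a b `&` [set x | ~ exists l, has_cube_derivative phi x l]).
have N0 : lebesgue_outer N = 0%E.
  apply: lebesgue_outer_eq0; apply: (le_trans (lebesgue_outer_setU _ _)).
  by rewrite lebesgue_outer_boundary// cube_derivative_ae// adde0.
have goodP x : ~ N x -> box a b x -> exists l,
    has_joint_derivative (box a b) f x l /\ grid_step phi a L k x @[k --> \oo]
      --> l.
  move=> xN xab.
  have xo : obox a b x by apply: contrapT => xo; apply: xN; left.
  have [l xl] : exists l, has_cube_derivative phi x l.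
    by apply: contrapT => nl; apply: xN; right.
  exists l; split; first exact: has_cube_joint_derivative xl.
  apply: cvg_grid_step => // i; have /andP[/ltW -> xb] := xo i.
  by have := leL i; rewrite !mxE; lra.
pose D : set (lebesgue_space R m.+1) := box a b.
have mD : measurable D by exact: measurable_box.
pose jd (x : lebesgue_space R m.+1) := (joint_derivative (box a b) f x)%:E.
pose g k (x : lebesgue_space R m.+1) := (grid_step phi a L k x)%:E.
have g0 k x : (0 <= g k x)%E by rewrite lee_fin grid_step_ge0.
have mg k : measurable_fun D (g k) by exact: measurable_grid_step.
have limE x : ~ N x -> D x -> limn_einf (g ^~ x) = jd x /\ limn_esup (g ^~ x) =
  jd x.
  move=> xN /(goodP _ xN)[l [/has_joint_derivative_unique jdl gl]].
  have [//|-> ->] := @cvg_limn_einf_sup R (g ^~ x) (l%:E).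
    by apply/cvg_EFin => //; exact: nearW.
  by rewrite /jd jdl.
(* Although [f] itself may fail to be measurable, [jd] agrees almost everywhere with a limit
   superior of step functions, and the measure is complete. *)
have mjd : measurable_fun D jd.
  apply: (ae_measurable_fun lebesgue_measure_complete (f := fun x => limn_esup
    (g ^~ x))).
    by apply: (lebesgue_outer_ae N0) => x xN Dx; have [] := limE x xN Dx.
  exact: measurable_fun_limn_esup.
have jd0 x : (0 <= jd x)%E by rewrite lee_fin joint_derivative_ge0.
split.
- by apply: (lebesgue_outer_ae N0) => x xN /(goodP _ xN)[l []]; exists l.
- exact/measurable_EFinP.
have -> : (\int[@lebesgue_measure_rV R m.+1]_(x in D) jd x =
    \int[@lebesgue_measure_rV R m.+1]_(x in D) limn_einf (g ^~ x))%E.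
  have jdE : ae_eq (@lebesgue_measure_rV R m.+1) D jd (fun x => limn_einf (g ^~ x)).
    by apply: (lebesgue_outer_ae N0) => x xN Dx; have [] := limE x xN Dx.
  have mg_inf := ae_measurable_fun lebesgue_measure_complete jdE mjd.
  apply: (ge0_ae_eq_integral mD mjd mg_inf (fun x _ => jd0 x) _ jdE).
  move=> x _; rewrite limn_einf_lim; apply: lime_ge; first exact: is_cvg_einfs.
  by apply: nearW => k; apply: le_ereal_inf_tmp => _ [j _ <-]; exact: g0.
apply: (le_trans (fatou _ mD mg (fun k x _ => g0 k x))).
(* The limit inferior of the integrals is a limit of infima over tails, and the infimum from [k] on
   is at most the integral of [g k]. *)
rewrite limn_einf_lim; apply: lime_le; first exact: is_cvg_einfs.
apply: nearW => k; rewrite -phiL.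
apply: (@le_trans _ _ (\int[@lebesgue_measure_rV R m.+1]_(x in D) g k x)%E).
  by apply: ereal_inf_lbound; exists k => /=.
exact: integral_grid_step.
Qed.
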